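(* Consider the equal-neighbor, time-invariant, bidirectional agreement iteration $x(t+1)=Ax(t)$ on connected symmetric graphs, with convergence time $T_n(\epsilon)$. Then $T_n(\epsilon)=O(n^3\log(n/\epsilon))$, and for every $n$ there is a connected graph on $n$ nodes for which $T_n(\epsilon)=\Omega(n^3\log(1/\epsilon))$. Explicitly: (i) There exist a constant $c>0$ and an integer $n_0$ such that for every $n\ge n_0$, every connected symmetric graph on $n$ nodes, and every $\epsilon\in(0,1)$, the corresponding convergence time satisfies $T_n(\epsilon)\le c\,n^3\log(n/\epsilon)$. (ii) There exist a constant $c'>0$ and an integer $n_0'$ such that for every $n\ge n_0'$ there exists a connected symmetric graph on $n$ nodes for which $T_n(\epsilon)\ge c'\,n^3\log(1/\epsilon)$ for every $\epsilon\in(0,1)$.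
   Context: Graphs are directed graphs $G=(\mathcal N,\mathcal E)$ with $\mathcal N=\{1,\ldots,n\}$, and always contain all self-arcs $(i,i)$. $G$ is symmetric if $(i,j)\in\mathcal E$ if and only if $(j,i)\in\mathcal E$. Let $\mathcal N_i=\{j:(j,i)\in\mathcal E\}$ (which includes $i$) and $d_i=|\mathcal N_i|$. The equal-neighbor, time-invariant, bidirectional model on a symmetric graph $G$ is the iteration $x(t+1)=Ax(t)$, where $a_{ij}=1/d_i$ if $j\in\mathcal N_i$ and $a_{ij}=0$ otherwise. On a connected graph, $x(t)$ converges to a limit $x^*=\lim_{t\to\infty}x(t)$ (depending on $x(0)$) that is a multiple of the all-ones vector $\mathbf 1$. Let $X=\{c\mathbf 1:c\in\mathbb R\}$. The convergence time is $$T_n(\epsilon)=\min\Big\{\tau:\ \frac{\|x(t)-x^*\|_\infty}{\|x(0)-x^*\|_\infty}\le\epsilon\ \ \forall\,t\ge\tau,\ \forall\,x(0)\notin X\Big\}.$$ $\log$ is the base-2 logarithm. The notation $f(n)=O(g(n))$ (respectively $f(n)=\Omega(g(n))$) means that there are a constant $c>0$ and some $n_0$ with $f(n)\le cg(n)$ (respectively $f(n)\ge cg(n)$) for all $n\ge n_0$. *)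

(* Defs.v *)
From mathcomp Require Import all_boot all_order all_algebra.
From mathcomp Require Import all_classical all_reals all_analysis.

Set Implicit Arguments.
Unset Strict Implicit.
Unset Printing Implicit Defensive.

Import Order.TTheory GRing.Theory Num.Theory.
Import numFieldNormedType.Exports.

Local Open Scope classical_set_scope.
Local Open Scope ring_scope.

(* A directed graph on n nodes is a relation e on 'I_n, with e i j meaning
   that (i, j) is an arc. *)
Definition connected_symmetric_graph (n : nat) (e : rel 'I_n) : Prop :=
  [/\ reflexive e, symmetric e & forall i j : 'I_n, connect e i j].

Definition neighbors (n : nat) (e : rel 'I_n) (i : 'I_n) : {set 'I_n} :=
  [set j | e j i]%SET.

Definition degree (n : nat) (e : rel 'I_n) (i : 'I_n) : nat :=
  #|neighbors e i|.

Definition equal_neighbor_mx (R : realType) (n : nat) (e : rel 'I_n) : 'M[R]_n :=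
  \matrix_(i, j) if j \in neighbors e i then (degree e i)%:R^-1 else 0.

Definition agreement_iter (R : realType) (n : nat) (e : rel 'I_n)
    (x0 : 'cV[R]_n) (t : nat) : 'cV[R]_n :=
  iter t (mulmx (equal_neighbor_mx R e)) x0.

(* [lim] is total; on a connected symmetric graph the sequence converges. *)
Definition agreement_limit (R : realType) (n : nat) (e : rel 'I_n)
    (x0 : 'cV[R]_n) : 'cV[R]_n :=
  lim (agreement_iter e x0 t @[t --> \oo]).

Definition consensus_set (R : realType) (n : nat) : set 'cV[R]_n :=
  [set x | exists c : R, x = const_mx c].

(* The norm of a column vector is the sup norm of its entries (mx_norm). *)
Definition contracts_from (R : realType) (n : nat) (e : rel 'I_n) (eps : R)
    (tau : nat) : Prop :=
  forall (t : nat) (x0 : 'cV[R]_n), (tau <= t)%N -> ~ consensus_set x0 ->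
    `|agreement_iter e x0 t - agreement_limit e x0|
      / `|x0 - agreement_limit e x0| <= eps.

(* tau = T_n(eps): the minimum is attained at tau. *)
Definition is_convergence_time (R : realType) (n : nat) (e : rel 'I_n) (eps : R)
    (tau : nat) : Prop :=
  contracts_from e eps tau /\
  forall tau' : nat, contracts_from e eps tau' -> (tau <= tau')%N.

Definition log2 (R : realType) (x : R) : R := ln x / ln 2.

(* Main.v *)
Require Import Defs.
From mathcomp Require Import all_boot all_order all_algebra.
From mathcomp Require Import all_classical all_reals all_analysis.
From mathcomp Require Import ring lra zify.

Set Implicit Arguments.
Unset Strict Implicit.
Unset Printing Implicit Defensive.

Import Order.TTheory GRing.Theory Num.Theory.
Import numFieldNormedType.Exports.

Local Open Scope ring_scope.

(** The averaging matrix A is self-adjoint for the inner product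
    [wdot x y] = sum_i d_i x_i y_i weighted by the degrees, and it fixes the
    constant vectors.  Hence the weighted mean is conserved, the limit of the
    iteration is that mean ([agreement_limitE]), and everything happens on the
    vectors y orthogonal to the constants.  There one step loses exactly

        wdot y y - wdot (A y) (A y) = sum_i D_i,

    where D_i is the sum of (y_j - (A y)_i)^2 over the neighbors j of i
    ([wdot_step_loss]): replacing the values around i by their average costs
    their spread.

    Upper bound.  Since i is its own neighbor, every arc (i, j) satisfies
    (y_i - y_j)^2 <= 2 D_i; the degrees do not enter.  Cauchy-Schwarz along a
    simple path, which has fewer than n arcs, gives
    (y_u - y_v)^2 <= 2 n sum_i D_i for all u and v, and since the degrees sum
    to at most n^2 this yields the Poincare inequality
    wdot y y <= 2 n^3 sum_i D_i ([poincare]).  So each step contracts wdot y y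
    by 1 - 1/(2 n^3), and passing between the sup norm and the weighted norm
    costs a factor n only, absorbed by the logarithm of n / eps.

    Lower bound.  The numbers wdot (A^t y) (A^t y) form a log-convex sequence
    because A is self-adjoint, so they decay no faster than the ratio q of the
    first two terms: the Rayleigh quotient of y bounds the decay without any
    spectral decomposition ([wdot_iter_ge]).  If the iteration contracts by eps
    after T steps, it contracts by eps^k after k T steps, and letting k grow
    removes the constants between the two norms: q^T <= eps^2
    ([contracts_from_rate_le]).  It remains to find a graph and a vector with
    1 - q of order n^-3.  Two cliques of size n/3 joined by a path of length
    about n/3 do this: a height function that is constant on the cliques and
    increases by at most one per step along the path has total spread O(n),
    while its weighted variance is of order n^4 ([sum_local_spread_height],
    [wdot_height_ge]). *)

(** * Sup norm of column vectors, and Bernoulli's inequality *)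

Lemma entry_le_norm (R : realType) n (x : 'cV[R]_n) i : `|x i 0| <= `|x|.
Proof.
rewrite [`|x|]mx_normrE.
exact: (le_bigmax _ (fun ij : 'I_n * 'I_1 => `|x ij.1 ij.2|) (i, 0)).
Qed.

Lemma norm_le_entries (R : realType) n (x : 'cV[R]_n) (c : R) :
  0 <= c -> (forall i, `|x i 0| <= c) -> `|x| <= c.
Proof.
move=> c0 xc; rewrite [`|x|]mx_normrE; apply/bigmax_le => // -[i j] _ /=.
by rewrite (ord1 j).
Qed.

Lemma bernoulli_ineq (R : realType) (a : R) (k : nat) :
  0 <= a -> 1 + k%:R * a <= (1 + a) ^+ k.
Proof.
move=> a0; elim: k => [|k IH]; first by rewrite mul0r addr0 expr0.
have a1 : 0 <= 1 + a by rewrite addr_ge0.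
rewrite exprS (le_trans _ (ler_wpM2l a1 IH)) // -natr1.
have : 0 <= k%:R * (a * a) by rewrite !mulr_ge0.
lra.
Qed.

(** * Degree-weighted energy *)

Section Energy.

Variables (R : realType) (n : nat) (e : rel 'I_n).
Hypothesis graph_e : connected_symmetric_graph e.

Local Notation A := (equal_neighbor_mx R e).
Local Notation d i := ((degree e i)%:R : R).
Implicit Types (x y z : 'cV[R]_n) (i j : 'I_n).

Lemma graph_refl i : e i i.
Proof. by case: graph_e. Qed.

Lemma graph_sym i j : e i j = e j i.
Proof. by case: graph_e. Qed.

Lemma degree_gt0 i : (0 < degree e i)%N.
Proof. by apply/card_gt0P; exists i; rewrite inE graph_refl. Qed.

Lemma degree_ge1 i : 1 <= d i.
Proof. by rewrite ler1n degree_gt0. Qed.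

Lemma degree_neq0 i : d i != 0.
Proof. by rewrite pnatr_eq0 -lt0n degree_gt0. Qed.

Lemma degree_le i : d i <= n%:R.
Proof. by rewrite ler_nat -[leqRHS]card_ord max_card. Qed.

Lemma sum_neighbors_cst i (c : R) : \sum_(j | e j i) c = d i * c.
Proof.
rewrite big_const iter_addr_0 mulr_natl; congr (_ *+ _).
by apply: eq_card => j; rewrite inE.
Qed.

Lemma agreement_stepE x i : (A *m x) i 0 = (d i)^-1 * \sum_(j | e j i) x j 0.
Proof.
rewrite mxE big_distrr [RHS]big_mkcond; apply: eq_bigr => j _.
by rewrite mxE inE; case: ifP => //= _; rewrite mul0r.
Qed.

Lemma degree_agreement_step x i : d i * (A *m x) i 0 = \sum_(j | e j i) x j 0.
Proof. by rewrite agreement_stepE mulVKf ?degree_neq0. Qed.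

Lemma agreement_step_const (c : R) : A *m const_mx c = const_mx c :> 'cV[R]_n.
Proof.
apply/colP => i; rewrite agreement_stepE mxE.
under eq_bigr do rewrite mxE.
by rewrite sum_neighbors_cst mulKf ?degree_neq0.
Qed.

Definition wdot x y : R := \sum_i d i * (x i 0 * y i 0).

Lemma wdotC x y : wdot x y = wdot y x.
Proof. by apply: eq_bigr => i _; rewrite (mulrC (x i 0)). Qed.

Lemma wdotDl x y z : wdot (x + y) z = wdot x z + wdot y z.
Proof. by rewrite -big_split; apply: eq_bigr => i _; rewrite mxE /=; ring. Qed.

Lemma wdotZl (c : R) x y : wdot (c *: x) y = c * wdot x y.
Proof. by rewrite big_distrr; apply: eq_bigr => i _; rewrite mxE /=; ring. Qed.

Lemma wdotDr x y z : wdot z (x + y) = wdot z x + wdot z y.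
Proof. by rewrite !(wdotC z) wdotDl. Qed.

Lemma wdotZr (c : R) x y : wdot y (c *: x) = c * wdot y x.
Proof. by rewrite !(wdotC y) wdotZl. Qed.

Lemma wdot_ge0 x : 0 <= wdot x x.
Proof.
by apply: sumr_ge0 => i _; rewrite mulr_ge0 // -expr2 sqr_ge0.
Qed.

Lemma wdot_eq0 x : wdot x x = 0 -> x = 0.
Proof.
have h i : true -> 0 <= d i * (x i 0 * x i 0).
  by move=> _; rewrite mulr_ge0 // -expr2 sqr_ge0.
move/eqP; rewrite psumr_eq0// => /allP xx0; apply/colP => i.
have := xx0 i (mem_index_enum i).
by rewrite /= mulf_eq0 (negPf (degree_neq0 i)) -expr2 sqrf_eq0 mxE => /eqP.
Qed.

Lemma wdot_CauchySchwarz x y : wdot x y ^+ 2 <= wdot x x * wdot y y.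
Proof.
have [/wdot_eq0 ->|y0] := eqVneq (wdot y y) 0.
  have h z : wdot z 0 = 0 by rewrite -[0](scale0r y) wdotZr mul0r.
  by rewrite !h mulr0 expr0n.
have yy_gt0 : 0 < wdot y y by rewrite lt_neqAle eq_sym y0 wdot_ge0.
have := wdot_ge0 (wdot y y *: x + (- wdot x y) *: y).
rewrite !(wdotDl, wdotDr, wdotZl, wdotZr) (wdotC y x).
set u := wdot x x; set v := wdot y y; set w := wdot x y.
set t := (X in 0 <= X); have -> : t = v * (u * v - w ^+ 2) by rewrite /t; ring.
by rewrite pmulr_rge0 // subr_ge0.
Qed.

(** Both sides are the sum of x_j y_i over all arcs: multiplying row i of the
    averaging matrix by d_i leaves the adjacency matrix, which is symmetric. *)
Lemma wdot_agreement_step x y : wdot (A *m x) y = wdot x (A *m y).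
Proof.
transitivity (\sum_i \sum_(j | e j i) x j 0 * y i 0).
  by apply: eq_bigr => i _; rewrite mulrA degree_agreement_step mulr_suml.
rewrite (exchange_big_dep predT) //=; apply: eq_bigr => j _.
rewrite mulrCA degree_agreement_step mulr_sumr.
by apply: eq_bigl => i; rewrite graph_sym.
Qed.

(** d_i times the variance of x over the neighborhood of i. *)
Definition local_spread x i : R := \sum_(j | e j i) (x j 0 - (A *m x) i 0) ^+ 2.

Lemma local_spread_ge0 x i : 0 <= local_spread x i.
Proof. by apply: sumr_ge0 => j _; rewrite sqr_ge0. Qed.

Lemma sum_sqr_neighbors x i (c : R) :
  \sum_(j | e j i) (x j 0 - c) ^+ 2
    = \sum_(j | e j i) x j 0 ^+ 2 + d i * (c ^+ 2 - 2 * c * (A *m x) i 0).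
Proof.
transitivity (\sum_(j | e j i) (x j 0 ^+ 2 + (c ^+ 2 - 2 * c * x j 0))).
  by apply: eq_bigr => j _; ring.
rewrite big_split /= big_split /= sum_neighbors_cst sumrN -mulr_sumr.
by rewrite -degree_agreement_step; ring.
Qed.

(** The average over the neighborhood minimizes the sum of squares. *)
Lemma local_spread_le x i (c : R) :
  local_spread x i <= \sum_(j | e j i) (x j 0 - c) ^+ 2.
Proof.
rewrite /local_spread !sum_sqr_neighbors lerD2l ler_wpM2l //.
have := sqr_ge0 (c - (A *m x) i 0); lra.
Qed.

(** Bias-variance decomposition at every node: the sum of x_j^2 over the arcs
    (j, i) is wdot x x by symmetry, and at each i it splits into d_i (A x)_i^2
    plus the spread. *)
Lemma wdot_step_loss x :
  wdot (A *m x) (A *m x) = wdot x x - \sum_i local_spread x i.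
Proof.
have -> : wdot x x = \sum_i \sum_(j | e j i) x j 0 ^+ 2.
  rewrite (exchange_big_dep predT) //=; apply: eq_bigr => j _.
  rewrite -expr2 -sum_neighbors_cst; apply: eq_bigl => i; exact: graph_sym.
rewrite -sumrB; apply: eq_bigr => i _.
by rewrite /local_spread sum_sqr_neighbors; ring.
Qed.

(** * Poincare inequality and decay of the energy *)

(** Both endpoints belong to the neighborhood of i, thanks to the self-arc, so
    their two terms of the spread alone bound the squared difference. *)
Lemma sqr_arc_le x i j : e i j ->
  (x j 0 - x i 0) ^+ 2 <= 2 * local_spread x i.
Proof.
move=> eij; have [->|ji] := eqVneq j i.
  by rewrite subrr expr0n mulr_ge0 ?local_spread_ge0.
rewrite /local_spread (bigD1 i) ?graph_refl //= (bigD1 j) /=; last first.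
  by rewrite graph_sym eij.
set a := (A *m x) i 0; set s := \sum_(k | _) _.
have s0 : 0 <= s by apply: sumr_ge0 => k _; rewrite sqr_ge0.
have := sqr_ge0 ((x j 0 - a) + (x i 0 - a)); lra.
Qed.

(** Cauchy-Schwarz along the path.  The last node is included in the sum so that
    the nodes are those of the duplicate-free sequence [i :: p]. *)
Lemma sqr_path_le x i (p : seq 'I_n) : path e i p ->
  (x (last i p) 0 - x i 0) ^+ 2
    <= (size p)%:R * \sum_(j <- i :: p) 2 * local_spread x j.
Proof.
elim: p i => [|j p IH] i /=; first by rewrite subrr expr0n mul0r.
case/andP=> eij /IH; rewrite [in X in _ -> X]big_cons.
have := sqr_arc_le x eij.
set S := \sum_(k <- _) _; set D := 2 * _.
have S0 : 0 <= S by apply: sumr_ge0 => k _; rewrite mulr_ge0 ?local_spread_ge0.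
set b := x (last j p) 0 - x j 0; set a := x j 0 - x i 0 => aD.
have -> : x (last j p) 0 - x i 0 = b + a by rewrite /a /b; ring.
case: (size p) => [|k].
  rewrite mul0r => b0.
  have /eqP : b ^+ 2 = 0 by apply/le_anti; rewrite b0 sqr_ge0.
  by rewrite sqrf_eq0 => /eqP ->; rewrite add0r mul1r (le_trans aD) ?lerDl.
set K : R := k.+1%:R => bS; have K0 : 0 < K by rewrite ltr0Sn.
rewrite -[k.+2%:R]natr1 -/K.
(* K times the right-hand side minus K times the left one is at least
   (b - K a)^2. *)
rewrite -(ler_pM2l K0).
have h1 : K * K * a ^+ 2 <= K * K * D by rewrite ler_wpM2l ?mulr_ge0 // ltW.
have h2 : K * a ^+ 2 <= K * D by rewrite ler_wpM2l // ltW.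
have h3 : K * b ^+ 2 <= K * (K * S) by rewrite ler_wpM2l // ltW.
have := sqr_ge0 (b - K * a); lra.
Qed.

Lemma sqr_diff_le x i j :
  (x j 0 - x i 0) ^+ 2 <= 2 * n%:R * \sum_k local_spread x k.
Proof.
have [_ _ /(_ i j)/connectP[p0 ep0 ->]] := graph_e.
case/shortenP: ep0 => p ep up _.
apply: le_trans (sqr_path_le x ep) _.
have sz : (size p <= n)%N.
  by have := uniq_leq_size up (fun k _ => mem_enum 'I_n k);
     rewrite size_enum_ord => /ltnW.
rewrite -mulr_sumr mulrCA mulrA ler_pM ?mulr_ge0 ?ler_wpM2l ?ler_nat //.
  by apply: sumr_ge0 => k _; rewrite local_spread_ge0.
rewrite big_uniq //= [leRHS](bigID (mem (i :: p))) /= lerDl.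
by apply: sumr_ge0 => k _; rewrite local_spread_ge0.
Qed.

Local Notation one := (const_mx 1 : 'cV[R]_n).

(** For x orthogonal to the constants, subtracting the value of x at one node
    can only increase the weighted norm; each of the n terms is then at most
    n times a squared difference of two entries. *)
Lemma poincare x : wdot one x = 0 ->
  wdot x x <= 2 * n%:R ^+ 3 * \sum_k local_spread x k.
Proof.
have D0 : 0 <= \sum_k local_spread x k.
  by apply: sumr_ge0 => k _; rewrite local_spread_ge0.
move=> x1; have [i _|no_node] := pickP (@predT 'I_n); last first.
  rewrite [wdot x x]big1 ?mulr_ge0 ?exprn_ge0 // => k _.
  by have := no_node k.
pose c := x i 0; move: D0; set D := \sum_k _ => D0.
have -> : wdot x x = wdot (x - c *: one) (x - c *: one) - c ^+ 2 * wdot one one.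
  rewrite -scaleNr !(wdotDl, wdotDr, wdotZl, wdotZr) (wdotC x one) x1; ring.
rewrite lerBlDr -[leLHS]addr0 lerD ?(mulr_ge0 (sqr_ge0 c) (wdot_ge0 one)) //.
apply: (@le_trans _ _ (\sum_(j < n) n%:R * (2 * n%:R * D))); last first.
  by rewrite sumr_const card_ord -[leLHS]mulr_natl le_eqVlt; apply/orP; left;
     apply/eqP; ring.
apply: ler_sum => j _; rewrite !mxE mulr1 -expr2.
by rewrite ler_pM ?sqr_ge0 ?degree_le ?sqr_diff_le.
Qed.

Lemma wdot_contract x : wdot one x = 0 ->
  wdot (A *m x) (A *m x) <= (1 - (2 * n%:R ^+ 3)^-1) * wdot x x.
Proof.
move=> x1; rewrite wdot_step_loss mulrBl mul1r lerD2l lerN2.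
case: (posnP n) => [n0|n_gt0].
  by rewrite {1}n0 expr0n mulr0 invr0 mul0r sumr_ge0 // => k _;
     exact: local_spread_ge0.
by rewrite ler_pdivrMl ?mulr_gt0 ?exprn_gt0 ?ltr0n // poincare.
Qed.

(** * Conserved mean, limit and contraction of the iteration *)

Hypothesis n_gt0 : (0 < n)%N.

Lemma sqr_norm_le_wdot x : `|x| ^+ 2 <= wdot x x.
Proof.
rewrite -[leRHS]sqr_sqrtr ?wdot_ge0 // ler_pXn2r ?nnegrE ?sqrtr_ge0 //.
apply: norm_le_entries => [|i]; first exact: sqrtr_ge0.
rewrite -sqrtr_sqr ler_wsqrtr // /wdot (bigD1 i) //= -expr2 -[leLHS]addr0.
rewrite lerD ?ler_peMl ?sqr_ge0 ?degree_ge1 //.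
by apply: sumr_ge0 => j _; rewrite mulr_ge0 // -expr2 sqr_ge0.
Qed.

Lemma wdot_le_sqr_norm x : wdot x x <= n%:R ^+ 2 * `|x| ^+ 2.
Proof.
apply: (@le_trans _ _ (\sum_(i < n) n%:R * `|x| ^+ 2)).
  apply: ler_sum => i _; rewrite ler_pM ?degree_le // -expr2 ?sqr_ge0 //.
  by rewrite -real_normK ?num_real // ler_pXn2r ?nnegrE // entry_le_norm.
by rewrite sumr_const card_ord -[leLHS]mulr_natl mulrA -expr2.
Qed.

Lemma agreement_iterS x t :
  agreement_iter e x t.+1 = A *m agreement_iter e x t.
Proof. by []. Qed.

Lemma agreement_iterD x s t :
  agreement_iter e x (s + t) = agreement_iter e (agreement_iter e x t) s.
Proof. exact: iterD. Qed.

Lemma agreement_iter_addcst x (c : R) t :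
  agreement_iter e (x + const_mx c) t = agreement_iter e x t + const_mx c.
Proof.
elim: t => [//|t IH].
by rewrite !agreement_iterS IH mulmxDr agreement_step_const.
Qed.

Lemma wdot_one_iter x t : wdot one (agreement_iter e x t) = wdot one x.
Proof.
elim: t => [//|t IH].
by rewrite agreement_iterS -wdot_agreement_step // agreement_step_const.
Qed.

Definition contraction_rate : R := 1 - (2 * n%:R ^+ 3)^-1.

Lemma contraction_rate_ge0 : 0 <= contraction_rate.
Proof.
rewrite subr_ge0 invf_le1 ?mulr_gt0 ?exprn_gt0 ?ltr0n //.
by rewrite -natrX -natrM ler1n muln_gt0 expn_gt0 n_gt0.
Qed.

Lemma wdot_iter_decay y t : wdot one y = 0 ->
  wdot (agreement_iter e y t) (agreement_iter e y t)
    <= contraction_rate ^+ t * wdot y y.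
Proof.
move=> y1; elim: t => [|t IH]; first by rewrite expr0 mul1r.
rewrite agreement_iterS.
apply: le_trans (wdot_contract (etrans (wdot_one_iter y t) y1)) _.
rewrite -/contraction_rate [contraction_rate ^+ _]exprS -mulrA.
by rewrite ler_wpM2l ?contraction_rate_ge0.
Qed.

Lemma norm_iter_decay y t : wdot one y = 0 ->
  `|agreement_iter e y t| ^+ 2
    <= contraction_rate ^+ t * (n%:R ^+ 2 * `|y| ^+ 2).
Proof.
move=> y1; apply: le_trans (sqr_norm_le_wdot _) _.
apply: le_trans (wdot_iter_decay t y1) _.
by rewrite ler_wpM2l ?wdot_le_sqr_norm // exprn_ge0 // contraction_rate_ge0.
Qed.

Definition weighted_mean x : R := wdot one x / wdot one one.

Lemma wdot_one_gt0 : 0 < wdot one one.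
Proof.
rewrite lt_neqAle wdot_ge0 andbT eq_sym; apply/eqP => /wdot_eq0.
by move/colP/(_ (Ordinal n_gt0))/eqP; rewrite !mxE oner_eq0.
Qed.

Lemma wdot_one_centered x : wdot one (x - const_mx (weighted_mean x)) = 0.
Proof.
have -> : const_mx (weighted_mean x) = weighted_mean x *: one.
  by apply/colP => i; rewrite !mxE mulr1.
rewrite -scaleNr wdotDr wdotZr mulNr divfK ?subrr //.
by rewrite gt_eqF ?wdot_one_gt0.
Qed.

Lemma agreement_iter_centered x t :
  agreement_iter e x t - const_mx (weighted_mean x)
    = agreement_iter e (x - const_mx (weighted_mean x)) t.
Proof.
rewrite -{1}(subrK (const_mx (weighted_mean x)) x).
by rewrite agreement_iter_addcst addrK.
Qed.

Lemma agreement_limitE x : agreement_limit e x = const_mx (weighted_mean x).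
Proof.
apply: cvg_lim => //.
set c := const_mx _; set y := x - c.
apply/cvgrPdist_lt => eps eps0.
have K0 : (contraction_rate ^+ t * (n%:R ^+ 2 * `|y| ^+ 2) @[t --> \oo]
    --> (0 : R))%classic.
  rewrite -[0](mul0r (n%:R ^+ 2 * `|y| ^+ 2)); apply: cvgMl.
  apply: cvg_expr; rewrite ger0_norm ?contraction_rate_ge0 // gtrBl invr_gt0.
  by rewrite mulr_gt0 ?exprn_gt0 ?ltr0n.
have e2 : 0 < eps ^+ 2 by rewrite exprn_gt0.
move/cvgrPdist_lt/(_ _ e2): K0; apply: filterS => t.
rewrite sub0r normrN => /(le_lt_trans (ler_norm _)).
move/(le_lt_trans (norm_iter_decay t (wdot_one_centered x))).
rewrite -agreement_iter_centered -/c distrC ltr_pXn2r ?nnegrE //.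
exact: ltW.
Qed.

Lemma contraction_rate_pow_le t :
  contraction_rate ^+ t <= expR (- (t%:R / (2 * n%:R ^+ 3))).
Proof.
rewrite -mulrN expRM_natl; apply: lerXn2r.
- by rewrite nnegrE contraction_rate_ge0.
- by rewrite nnegrE expR_ge0.
exact: expR_ge1Dx.
Qed.

(** The exponential bound on the contraction rate makes the squared ratio at
    most n^2 (eps / n)^2 = eps^2. *)
Lemma contracts_from_log (eps : R) tau : 0 < eps ->
  4 * n%:R ^+ 3 * ln (n%:R / eps) <= tau%:R -> contracts_from e eps tau.
Proof.
move=> eps0 tau_ge t x0 tau_t x0X.
rewrite agreement_limitE agreement_iter_centered.
have y1 := wdot_one_centered x0.
have y0 : 0 < `|x0 - const_mx (weighted_mean x0)|.
  rewrite normr_gt0 subr_eq0; apply/eqP => x0c; apply: x0X.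
  by exists (weighted_mean x0).
move: y1 y0; set y := x0 - _ => y1 y0.
rewrite ler_pdivrMr // -(@ler_pXn2r _ 2) ?nnegrE ?mulr_ge0 // ?(ltW eps0) //.
apply: le_trans (norm_iter_decay t y1) _.
rewrite exprMn mulrA ler_wpM2r ?sqr_ge0 //.
have n0 : (0 : R) < n%:R by rewrite ltr0n.
rewrite -ler_pdivlMr ?exprn_gt0 // (le_trans (contraction_rate_pow_le t)) //.
have -> : eps ^+ 2 / n%:R ^+ 2 = expR (- (ln (n%:R / eps) *+ 2)).
  by rewrite expRN -[_ *+ 2]mulr_natl expRM_natl lnK ?posrE ?divr_gt0 //
     -[RHS]exprVn invf_div expr_div_n.
rewrite ler_expR lerN2 ler_pdivlMr ?mulr_gt0 ?exprn_gt0 //.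
have tt : tau%:R <= t%:R :> R by rewrite ler_nat.
apply: le_trans (le_trans tau_ge tt).
by rewrite le_eqVlt; apply/orP; left; apply/eqP; ring.
Qed.

Lemma agreement_iter0 t : agreement_iter e (0 : 'cV[R]_n) t = 0.
Proof. by elim: t => [//|t IH]; rewrite agreement_iterS IH mulmx0. Qed.

(** A consensus vector orthogonal to the constants is zero, so the restriction
    to non-consensus initial values disappears here. *)
Lemma contracts_from_centered (eps : R) tau y : contracts_from e eps tau ->
  wdot one y = 0 -> `|agreement_iter e y tau| <= eps * `|y|.
Proof.
move=> ctr y1; have [->|y0] := eqVneq y 0.
  by rewrite agreement_iter0 normr0 mulr0.
have lim0 : agreement_limit e y = 0.
  by rewrite agreement_limitE /weighted_mean y1 mul0r;
     apply/colP => i; rewrite !mxE.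
have yX : ~ consensus_set y.
  case=> c yc; move/eqP: y0; apply; move: y1; rewrite yc.
  have -> : const_mx c = c *: one by apply/colP => i; rewrite !mxE mulr1.
  rewrite wdotZr => /eqP.
  rewrite mulf_eq0 (gt_eqF wdot_one_gt0) orbF => /eqP ->.
  exact: scale0r.
by have := ctr tau y (leqnn _) yX; rewrite lim0 !subr0 ler_pdivrMr ?normr_gt0.
Qed.

Lemma contracts_from_pow (eps : R) tau y k : 0 <= eps ->
  contracts_from e eps tau -> wdot one y = 0 ->
  `|agreement_iter e y (k * tau)| <= eps ^+ k * `|y|.
Proof.
move=> eps0 ctr y1; elim: k => [|k IH]; first by rewrite expr0 mul1r.
rewrite mulSn agreement_iterD.
apply: le_trans (contracts_from_centered ctr _) _.
  by rewrite wdot_one_iter.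
by rewrite exprS -mulrA ler_wpM2l.
Qed.

(** With v_t = wdot (A^t y) (A^t y), self-adjointness and Cauchy-Schwarz give
    v_(t+1)^2 = wdot (A^t y) (A^(t+2) y)^2 <= v_t v_(t+2): the ratios
    v_(t+1) / v_t are nondecreasing, hence all at least q. *)
Lemma wdot_iter_ge y (q : R) t : 0 < q -> 0 < wdot y y ->
  q * wdot y y <= wdot (A *m y) (A *m y) ->
  q ^+ t * wdot y y <= wdot (agreement_iter e y t) (agreement_iter e y t).
Proof.
move=> q0 y0 hq; pose v s := wdot (agreement_iter e y s) (agreement_iter e y s).
suff H s : 0 < v s /\ q * v s <= v s.+1.
  elim: t => [|t IH]; first by rewrite expr0 mul1r.
  rewrite exprS -mulrA (le_trans _ (H t).2) // ler_wpM2l //; exact: ltW.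
elim: s => [//|s [vs0 vs1]].
have vs1_gt0 : 0 < v s.+1 by rewrite (lt_le_trans _ vs1) // mulr_gt0.
split=> //.
have logconv : v s.+1 ^+ 2 <= v s * v s.+2.
  by rewrite {1}/v agreement_iterS wdot_agreement_step -agreement_iterS
     wdot_CauchySchwarz.
rewrite -(ler_pM2l vs0) (le_trans _ logconv) // expr2 mulrA.
rewrite ler_wpM2r ?(ltW vs1_gt0) //.
by rewrite mulrC.
Qed.

(** Comparing the decay by at least q^(k tau) with the contraction by eps^k
    bounds the powers (q^tau / eps^2)^k by n^2 for all k. *)
Lemma contracts_from_rate_le (eps : R) tau y (q : R) : 0 < eps ->
  contracts_from e eps tau -> wdot one y = 0 -> 0 < wdot y y ->
  0 < q -> q * wdot y y <= wdot (A *m y) (A *m y) -> q ^+ tau <= eps ^+ 2.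
Proof.
move=> eps0 ctr y1 y0 q0 hq; rewrite leNgt; apply/negP => lt_q.
have e2 : 0 < eps ^+ 2 by rewrite exprn_gt0.
pose r := q ^+ tau / eps ^+ 2.
have r1 : 0 < r - 1 by rewrite subr_gt0 ltr_pdivlMr // mul1r.
have bound k : r ^+ k <= n%:R ^+ 2.
  rewrite expr_div_n ler_pdivrMr ?exprn_gt0 // -(ler_pM2r y0) -exprM mulnC.
  apply: le_trans (wdot_iter_ge _ q0 y0 hq) _.
  apply: le_trans (wdot_le_sqr_norm _) _.
  rewrite -[leRHS]mulrA ler_wpM2l ?sqr_ge0 //.
  apply: (@le_trans _ _ ((eps ^+ k * `|y|) ^+ 2)).
    rewrite ler_pXn2r ?nnegrE ?mulr_ge0 ?exprn_ge0 ?(ltW eps0) //.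
    by apply: contracts_from_pow => //; exact: ltW.
  by rewrite exprMn exprAC ler_wpM2l ?sqr_norm_le_wdot // exprn_ge0 // ltW.
have := archi_boundP (_ : 0 <= n%:R ^+ 2 / (r - 1)).
rewrite divr_ge0 ?sqr_ge0 ?(ltW r1) // => /(_ isT); set k := Num.bound _.
rewrite ltr_pdivrMr // => hk.
have := bernoulli_ineq k (ltW r1); rewrite subrKC.
have := bound k; lra.
Qed.

(** Take q = 1 - delta above, and use - ln (1 - delta) <= 2 delta for delta at
    most 1/2. *)
Lemma contracts_from_ln_le (eps : R) tau y (delta : R) : 0 < eps ->
  contracts_from e eps tau -> wdot one y = 0 -> 0 < wdot y y ->
  delta <= 2^-1 -> \sum_i local_spread y i <= delta * wdot y y ->
  ln (1 / eps) <= delta * tau%:R.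
Proof.
move=> eps0 ctr y1 y0 d2 loss; have q0 : 0 < 1 - delta by lra.
have /(contracts_from_rate_le eps0 ctr y1 y0 q0) :
    (1 - delta) * wdot y y <= wdot (A *m y) (A *m y).
  by rewrite wdot_step_loss mulrBl mul1r lerD2l lerN2.
rewrite -ler_ln ?posrE ?exprn_gt0 // !lnXn // => h.
have delta0 : 0 <= delta.
  rewrite -(pmulr_lge0 _ y0) (le_trans _ loss) //.
  by apply: sumr_ge0 => i _; exact: local_spread_ge0.
have hln : - (2 * delta) <= ln (1 - delta).
  rewrite -[1 - delta]invrK lnV ?posrE ?invr_gt0 // lerN2.
  rewrite -[(1 - delta)^-1](subrKC 1) (le_trans (le_ln1Dx _)) //.
    by rewrite ltrBrDl subrr invr_gt0.
  rewrite lerBlDl -[leLHS]div1r ler_pdivrMr //.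
  have : 0 <= delta * (2^-1 - delta) by rewrite mulr_ge0 // subr_ge0.
  lra.
rewrite div1r lnV ?posrE //.
move: h; rewrite -mulr_natl -[ln eps *+ 2]mulr_natl => h.
have := ler_wpM2l (ler0n R tau) hln; lra.
Qed.

End Energy.
(** * Convergence time *)

Lemma convergence_time_exists (R : realType) (n : nat) (e : rel 'I_n)
    (eps : R) (tau : nat) :
  contracts_from e eps tau ->
  exists T : nat, is_convergence_time e eps T /\ (T <= tau)%N.
Proof.
move=> ctr; have exT : exists T, `[< contracts_from e eps T >].
  by exists tau; apply/asboolP.
case: (ex_minnP exT) => T /asboolP T_ctr T_min; exists T; split; last first.
  by apply: T_min; apply/asboolP.
by split=> // tau' tau'_ctr; apply: T_min; apply/asboolP.
Qed.

(** The constant is 4 from [contracts_from_log] plus 1 that absorbs rounding up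
    to an integer, since n^3 ln (n / eps) >= 1 as soon as n >= 2. *)
Lemma convergence_time_le (R : realType) (n : nat) (e : rel 'I_n) (eps : R) :
  connected_symmetric_graph e -> (2 <= n)%N -> 0 < eps < 1 ->
  exists T : nat, is_convergence_time e eps T /\
    T%:R <= 5 * n%:R ^+ 3 * ln (n%:R / eps).
Proof.
move=> ge n2 /andP[eps0 eps1].
have n0 : (0 < n)%N by apply: leq_trans n2.
have nR : 2 <= n%:R :> R by rewrite ler_nat.
set L := ln (n%:R / eps).
have L_ge : 2^-1 <= L.
  have ne0 : 0 < eps / n%:R by rewrite divr_gt0 // ltr0n.
  have ne : eps / n%:R <= 2^-1 by rewrite ler_pdivrMr ?ltr0n //; lra.
  rewrite /L -invf_div lnV ?posrE // -(subrKC 1 (eps / n%:R)).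
  have h : -1 < eps / n%:R - 1 by rewrite ltrBrDr addNr.
  have := le_ln1Dx h; lra.
have n3 : 8 <= n%:R ^+ 3 :> R.
  have -> : 8 = 2 ^+ 3 :> R by rewrite -natrX.
  by rewrite lerXn2r ?nnegrE.
have nL : 1 <= n%:R ^+ 3 * L.
  have := ler_pM (_ : 0 <= 8) (_ : 0 <= 2^-1) n3 L_ge; lra.
set B := 4 * n%:R ^+ 3 * L.
have B0 : 0 <= B by rewrite /B -mulrA; lra.
have [|T [T_time T_le]] := @convergence_time_exists _ _ e eps (Num.trunc B).+1.
  by apply: contracts_from_log => //; apply/ltW/truncnS_gt.
exists T; split=> //.
apply: (@le_trans _ _ (Num.trunc B).+1%:R); first by rewrite ler_nat.
rewrite -natr1; have /andP[+ _] := truncn_itv B0.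
rewrite /B; lra.
Qed.

(** * The barbell graph *)

Section Barbell.

Variables (R : realType) (n m : nat).
Hypothesis mn : (3 * m <= n)%N.

Definition barbell : rel 'I_n := fun i j =>
  [|| (i <= j.+1)%N && (j <= i.+1)%N, (i < m)%N && (j < m)%N
    | (n - m <= i)%N && (n - m <= j)%N].

Lemma barbell_graph : connected_symmetric_graph barbell.
Proof.
have sym : symmetric barbell.
  by move=> i j; rewrite /barbell; congr [|| _, _ | _]; rewrite andbC.
split=> // [i|i j]; first by rewrite /barbell leqnSn.
have n0 : (0 < n)%N by apply: leq_ltn_trans (ltn_ord i).
have from0 k : connect barbell (Ordinal n0) k.
  case: k => k; elim: k => [|k IH] kn.
    by rewrite (_ : Ordinal kn = Ordinal n0) //; apply: val_inj.
  apply: connect_trans (IH (ltnW kn)) (connect1 _).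
  by rewrite /barbell /= leqnn ltnW // leqnSn.
by rewrite (connect_trans _ (from0 j)) // (sym_connect_sym sym) from0.
Qed.

Lemma card_ord_lt k : (k <= n)%N -> #|[set j : 'I_n | (j < k)%N]%SET| = k.
Proof.
move=> kn; rewrite -sum1_card -[RHS](card_ord k) -sum1_card.
rewrite (big_ord_widen _ (fun=> 1%N) kn).
by apply: eq_bigl => j; rewrite inE.
Qed.

Lemma card_ord_ge : #|[set j : 'I_n | (n - m <= j)%N]%SET| = m.
Proof.
have -> : [set j : 'I_n | (n - m <= j)%N]%SET
    = (~: [set j : 'I_n | (j < n - m)%N])%SET.
  by apply/setP => j; rewrite !inE -leqNgt.
rewrite cardsCs finset.setCK card_ord card_ord_lt ?leq_subr // subKn //.
by lia.
Qed.

Lemma degree_left (i : 'I_n) : (i < m)%N -> (m <= degree barbell i)%N.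
Proof.
move=> im; rewrite -[leqLHS](@card_ord_lt m); last by lia.
by apply: subset_leq_card; apply/fintype.subsetP => j;
   rewrite !inE /barbell im => ->; rewrite orbT.
Qed.

Lemma degree_right (i : 'I_n) : (n - m <= i)%N -> (m <= degree barbell i)%N.
Proof.
move=> im; rewrite -[leqLHS]card_ord_ge.
by apply: subset_leq_card; apply/fintype.subsetP => j;
   rewrite !inE /barbell im => ->; rewrite !orbT.
Qed.

(** Equal to m on the first clique, to n - m on the second one, and to the
    index in between: the steps at both ends of the path are at most one. *)
Definition height (i : nat) : nat := maxn m (minn i (n - m)).

Definition centered_height : 'cV[R]_n :=
  let f : 'cV_n := \col_i (height i)%:R in
  f - const_mx (weighted_mean barbell f).

Local Notation y := centered_height.

Lemma centered_height_diff (i j : 'I_n) :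
  y j 0 - y i 0 = (height j)%:R - (height i)%:R.
Proof. by rewrite !mxE; ring. Qed.

(** Only arcs between consecutive indices see a height difference: the arcs
    inside a clique join nodes of equal height.  The value of [i.-1] at 0 is
    harmless since it only adds a nonnegative term. *)
Lemma sqr_height_diff (i j : 'I_n) : barbell j i ->
  ((height j)%:R - (height i)%:R) ^+ 2
    <= (j == i.+1 :> nat)%:R + (j == i.-1 :> nat)%:R :> R.
Proof.
rewrite /barbell /height => eji.
set a := maxn _ _; set b := maxn _ _.
have [->|ab] := eqVneq a b; first by rewrite subrr expr0n addr_ge0.
have /orP[/eqP ji|/eqP ji] : (j == i.+1 :> nat) || (j == i.-1 :> nat) by lia.
  have -> : a = b.+1 by lia.
  by rewrite ji eqxx -natr1 addrC addKr expr1n lerDl.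
have -> : b = a.+1 by lia.
by rewrite ji eqxx -natr1 opprD addNKr sqrrN expr1n lerDr.
Qed.

Lemma sum_eq_ord_le1 (P : pred 'I_n) k :
  \sum_(j | P j) (j == k :> nat)%:R <= 1 :> R.
Proof.
have [kn|nk] := ltnP k n; last first.
  by rewrite big1 // => j _; rewrite ltn_eqF // (leq_trans _ nk).
apply: (@le_trans _ _ (\sum_(j < n) (j == Ordinal kn)%:R)).
  by rewrite [leRHS](bigID P) /= lerDl sumr_ge0.
rewrite (bigD1 (Ordinal kn)) //= eqxx big1 ?addr0 // => j.
by move/negPf ->.
Qed.

Lemma sum_local_spread_height : \sum_i local_spread barbell y i <= 2 * n%:R.
Proof.
rewrite -[n in leRHS]card_ord mulr_natr -sumr_const.
apply: ler_sum => i _.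
apply: le_trans (local_spread_le barbell_graph _ _ (y i 0)) _.
apply: (@le_trans _ _ (\sum_(j | barbell j i)
    ((j == i.+1 :> nat)%:R + (j == i.-1 :> nat)%:R))).
  by apply: ler_sum => j eji; rewrite centered_height_diff sqr_height_diff.
by rewrite big_split /= -[2]/(1 + 1) lerD // sum_eq_ord_le1.
Qed.

(** Each clique has m nodes of degree at least m, and whatever the mean mu is,
    (m - mu)^2 + (n - m - mu)^2 >= (n - 2 m)^2 / 2 >= m^2 / 2. *)
Lemma wdot_height_ge : m%:R ^+ 4 / 2 <= wdot barbell y y.
Proof.
set mu := weighted_mean barbell (\col_(i < n) (height i)%:R : 'cV[R]_n).
pose a : R := m%:R * (m%:R - mu) ^+ 2.
pose b : R := m%:R * ((n - m)%:R - mu) ^+ 2.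
apply: (@le_trans _ _ (\sum_(i < n)
   ((if (i < m)%N then a else 0) + (if (n - m <= i)%N then b else 0)))).
  rewrite big_split -!big_mkcond /= !sumr_const.
  have -> : #|(fun i : 'I_n => (i < m)%N)| = m.
    by rewrite -[RHS](@card_ord_lt m); [apply: eq_card => i; rewrite inE | lia].
  have -> : #|(fun i : 'I_n => (n - m <= i)%N)| = m.
    by rewrite -[RHS]card_ord_ge; apply: eq_card => i; rewrite inE.
  rewrite -mulrnDl -[leRHS]mulr_natl /a /b -mulrDr mulrA -expr2.
  have -> : m%:R ^+ 4 / 2 = m%:R ^+ 2 * (m%:R ^+ 2 / 2) :> R by ring.
  rewrite ler_wpM2l ?sqr_ge0 //.
  have gap : m%:R <= (n - m)%:R - m%:R :> R by rewrite -natrB ?ler_nat; lia.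
  have : m%:R ^+ 2 <= ((n - m)%:R - m%:R) ^+ 2 :> R.
    by rewrite lerXn2r ?nnegrE // (le_trans _ gap).
  have := sqr_ge0 (((n - m)%:R - mu) + (m%:R - mu)); lra.
apply: ler_sum => i _; rewrite -expr2.
have yE : y i 0 = (height i)%:R - mu by rewrite !mxE.
have sq0 : 0 <= y i 0 ^+ 2 by rewrite sqr_ge0.
case: ifP => im; case: ifP => nmi.
- by move: im nmi; lia.
- rewrite addr0 yE; have -> : height i = m by rewrite /height; lia.
  by rewrite ler_wpM2r ?sqr_ge0 // ler_nat degree_left.
- rewrite add0r yE; have -> : height i = (n - m)%N by rewrite /height; lia.
  by rewrite ler_wpM2r ?sqr_ge0 // ler_nat degree_right.
- by rewrite addr0 mulr_ge0.
Qed.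

End Barbell.

(** The relative loss is at most 2 n / (m^4 / 2) = 4 n / m^4, and n <= 4 m turns
    this into 1024 / n^3; from n = 13 on this is at most 1/2. *)
Lemma barbell_convergence_time_ge (R : realType) (n : nat) (eps : R) T :
  (13 <= n)%N -> 0 < eps -> contracts_from (@barbell n (n %/ 3)) eps T ->
  n%:R ^+ 3 * ln (1 / eps) <= 1024 * T%:R.
Proof.
move=> n13 eps0 ctr; set m := (n %/ 3)%N.
have mn : (3 * m <= n)%N by rewrite /m; lia.
have nm : (n <= 4 * m)%N by rewrite /m; lia.
have n0 : (0 < n)%N by lia.
have ge := barbell_graph n m.
have n3 : (0 : R) < n%:R ^+ 3 by rewrite exprn_gt0 // ltr0n.
have hV := wdot_height_ge R mn.
have V0 : 0 < wdot (@barbell n m)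
    (centered_height R n m) (centered_height R n m).
  apply: lt_le_trans hV; rewrite divr_gt0 // exprn_gt0 // ltr0n; lia.
have delta_le : 1024 / n%:R ^+ 3 <= 2^-1 :> R.
  rewrite ler_pdivrMr // -[leLHS](mulKf (_ : 2 != 0)) // ler_pM2l ?invr_gt0 //.
  rewrite -natrX -natrM ler_nat.
  by apply: (@leq_trans (13 ^ 3)); rewrite ?leq_exp2r.
have loss : \sum_i local_spread (@barbell n m) (centered_height R n m) i
    <= 1024 / n%:R ^+ 3
       * wdot (@barbell n m) (centered_height R n m) (centered_height R n m).
  apply: le_trans (sum_local_spread_height R mn) _.
  have delta0 : 0 <= 1024 / n%:R ^+ 3 :> R.
    by apply: divr_ge0; [exact: ler0n | exact: ltW].
  apply: le_trans (ler_wpM2l delta0 hV).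
  rewrite mulrAC ler_pdivlMr //.
  have : n%:R ^+ 4 <= (4 * m%:R) ^+ 4 :> R.
    by rewrite lerXn2r ?nnegrE // -natrM ler_nat.
  lra.
have := contracts_from_ln_le ge n0 eps0 ctr
  (wdot_one_centered ge n0 _) V0 delta_le loss.
by rewrite mulrAC ler_pdivlMr // mulrC.
Qed.

(** * The bounds on the convergence time *)

Theorem corollary5p2 (R : realType) :
  (exists (c : R) (n0 : nat), 0 < c /\
    forall n : nat, (n0 <= n)%N ->
    forall e : rel 'I_n, connected_symmetric_graph e ->
    forall eps : R, 0 < eps < 1 ->
    exists T : nat, is_convergence_time e eps T /\
      T%:R <= c * n%:R ^+ 3 * log2 (n%:R / eps))
  /\
  (exists (c' : R) (n0' : nat), 0 < c' /\
    forall n : nat, (n0' <= n)%N ->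
    exists e : rel 'I_n, connected_symmetric_graph e /\
    forall eps : R, 0 < eps < 1 ->
    exists T : nat, is_convergence_time e eps T /\
      c' * n%:R ^+ 3 * log2 (1 / eps) <= T%:R).
Proof.
have ln2 : 0 < ln 2 :> R by rewrite ln_gt0 // ltr1n.
split.
  exists (5 * ln 2), 2%N; split=> [|n n2 e ge eps eps01].
    by rewrite mulr_gt0.
  have [T [T_time T_le]] := convergence_time_le ge n2 eps01.
  exists T; split=> //; apply: le_trans T_le _; rewrite /log2.
  rewrite le_eqVlt; apply/orP; left; apply/eqP; field.
  by rewrite gt_eqF.
have K0 : 0 < 1024 :> R by rewrite ltr0n.
exists (ln 2 / 1024), 13%N; split=> [|n n13]; first exact: divr_gt0.
exists (@barbell n (n %/ 3)); split=> [|eps eps01]; first exact: barbell_graph.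
have [|T [T_time _]] :=
    convergence_time_le (barbell_graph n (n %/ 3)) _ eps01.
  by lia.
exists T; split=> //; have /andP[eps0 _] := eps01.
have := barbell_convergence_time_ge n13 eps0 T_time.1.
rewrite -(ler_pdivrMl _ _ K0) => h; apply: le_trans h.
rewrite /log2 le_eqVlt; apply/orP; left; apply/eqP; field.
by rewrite (gt_eqF ln2).
Qed.
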